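(* Let $m,n,d,s\ge1$ be integers with $\gcd(m,n)=\gcd(d,s)=1$. There is a bijection between the set of cofinite $0$-normalized $s$-admissible $(nd,md)$-invariant subsets $\Delta\subset\mathbb{Z}_{\ge0}$ and the set of cabled Dyck paths with parameters $(n,m),(d,s)$.
   Context: $\Delta\subset\mathbb{Z}_{\ge0}$ is $(nd,md)$-invariant if $\Delta+nd\subset\Delta$ and $\Delta+md\subset\Delta$; cofinite if $\mathbb{Z}_{\ge0}\setminus\Delta$ is finite; $0$-normalized if $0\in\Delta$. An $(nd)$-generator of $\Delta$ is an $a\in\Delta$ with $a-nd\notin\Delta$; for cofinite $\Delta$ there is exactly one in each class mod $nd$, and those congruent to $j$ mod $d$ are denoted $a_{j,0},\dots,a_{j,n-1}$. $\Delta$ is $s$-admissible if for every $j\in\{0,\dots,d-1\}$ there exists $i$ such that $a_{j,i}+md+s\in\Delta$. An $(a,b)$-Dyck path is a lattice path with unit south and east steps from the northwest to the southeast corner of a rectangle of height $a$ and width $b$, staying weakly below the diagonal joining these corners. A cabled Dyck path with parameters $(n,m),(d,s)$ consists of: a $(d,s)$-Dyck path $P$ (the pattern), whose maximal vertical runs have lengths $v_1(P),\dots,v_k(P)$ in order (so $v_1(P)+\dots+v_k(P)=d$), together with an arbitrary tuple consisting of one $(v_i(P)n,v_i(P)m)$-Dyck path for each $1\le i\le k$. *)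

(* Defs.v *)
From mathcomp Require Import all_boot.
From mathcomp Require Import boolp classical_sets functions cardinality.

Set Implicit Arguments.
Unset Strict Implicit.
Unset Printing Implicit Defensive.

Local Open Scope classical_set_scope.

Definition cofinite (Delta : set nat) : Prop := finite_set (~` Delta).

Definition invariant (N M : nat) (Delta : set nat) : Prop :=
  (forall x, Delta x -> Delta (x + N)) /\ (forall x, Delta x -> Delta (x + M)).

Definition normalized0 (Delta : set nat) : Prop := Delta 0.

(* The elements a of Delta with a - N \notin Delta, where a - N is taken in Z:
   a - N \in Delta means that a = b + N for some b in Delta.  Truncated
   subtraction would be wrong for a < N. *)
Definition generators (N : nat) (Delta : set nat) : set nat :=
  Delta `\` [set b + N | b in Delta].

Definition admissible (n m d s : nat) (Delta : set nat) : Prop :=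
  forall j, j < d ->
    exists a, [/\ generators (n * d) Delta a, a = j %[mod d]
                & Delta (a + m * d + s)].

Definition admissible_sets (n m d s : nat) : set (set nat) :=
  [set Delta | [/\ cofinite Delta, normalized0 Delta,
                   admissible n m d s Delta
                 & invariant (n * d) (m * d) Delta]].

Definition step := bool.
Definition south : step := true.
Definition east : step := false.

(* A path in a rectangle of height a and width b, read from the northwest
   corner (0, a) to the southeast corner (b, 0).  After x east and y south steps
   it is at (x, a - y), which is weakly below the diagonal when
   a - y <= a - a * x / b, that is, when a * x <= b * y. *)
Definition dyck_path (a b : nat) (p : seq step) : Prop :=
  [/\ count_mem south p = a, count_mem east p = b
    & forall k, k <= size p ->
        a * count_mem east (take k p) <= b * count_mem south (take k p)].

(* The lengths, in order, of the maximal runs of south steps in the path made of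
   k south steps followed by p; empty runs are not recorded. *)
Fixpoint vruns_from (k : nat) (p : seq step) : seq nat :=
  match p with
  | [::] => if k is 0 then [::] else [:: k]
  | st :: p' =>
      if st == south then vruns_from k.+1 p'
      else if k is 0 then vruns_from 0 p' else k :: vruns_from 0 p'
  end.

Definition vruns (p : seq step) : seq nat := vruns_from 0 p.

Definition cabled_dyck_paths (n m d s : nat) :
    set (seq step * seq (seq step)) :=
  [set c | [/\ dyck_path d s c.1,
               size c.2 = size (vruns c.1)
             & forall i, i < size (vruns c.1) ->
                 dyck_path (nth 0 (vruns c.1) i * n) (nth 0 (vruns c.1) i * m)
                           (nth [::] c.2 i)]].

(* Main.v *)
Require Import Defs.
From mathcomp Require Import all_boot all_order all_algebra.
From mathcomp Require Import boolp classical_sets functions cardinality.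
From mathcomp Require Import zify ring.

(** Every integer is d x + s k for a unique pair with 0 <= k < d, so a set Delta
of natural numbers is a sequence D_0, ..., D_(d-1) of sets of integers, where
D_k consists of the x with d x + s k in Delta.  The set Delta is cofinite and
(nd, md)-invariant exactly when the D_k are semimodules: nonempty, bounded
below, closed under adding n and adding m.  With D_d = D_0 - s, admissibility
becomes a condition on the pairs (D_k, D_(k+1)).

Let L = n + m.  Since m and -n agree modulo L and m is invertible modulo L, one
can walk through the Apéry set of a semimodule (the least elements in the
classes modulo L) with steps +m and -n; this closed walk, the rim, has n steps
+m and m steps -n and determines the semimodule (lemma rim_inj).  The pair
(D_k, D_(k+1)) satisfies the admissibility condition exactly when some Apéry
element of D_k lies in D_(k+1) (lemma meets_generatorP).

Read D_0, D_1, ... in this order.  Whenever the minimum of D_k is a new record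
-x, the condition on (D_(k-1), D_k) holds automatically, and a new vertical run
of the pattern is opened in column x, with the rim of D_k, walked from -x, as
its cabling path.  The elements of Delta are nonnegative precisely when
d x <= s k for all these columns, which is the Dyck condition on the pattern;
this also makes the condition on (D_(d-1), D_d) automatic.  If the minimum is
not a record, the run gets one more south step, and the rim of D_k is inserted
in the current cabling path at the last moment when the height of the path
belongs to D_k.  Such a moment exists because the previous rim, which is a part
of the path, has a point in D_k.

Insertion can be undone: the inserted rim is the last closed subwalk of length
L, all later heights being lower than those L steps before (tail_loop_insert).
Every Dyck path of v loops has such a last closed subwalk, by a discrete
intermediate value argument (tail_loop_exists), and cutting it out gives back
the previous path together with the condition on consecutive semimodules
(tail_loop_cut).  Hence the cabling paths of a run of length v correspond to
the chains of v semimodules above the same record. *)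

Set Implicit Arguments.
Unset Strict Implicit.
Unset Printing Implicit Defensive.

Import GRing.Theory.

(** * Integers modulo coprime moduli *)

Section Arithmetic.
Local Open Scope ring_scope.

Lemma coprime_combination (N M : nat) (x : int) : (0 < N)%N -> coprime N M ->
  exists2 j : nat, (j < N)%N & exists q : int, x = M%:Z * j%:Z + N%:Z * q.
Proof.
move=> N0 cNM.
have [M0|M0] := posnP M.
  move: cNM; rewrite M0 /coprime gcdn0 => /eqP N1.
  by exists 0%N => //; exists x; lia.
have [km kn e _] := egcdnP N M0.
move: e; rewrite gcdnC (eqP cNM) => e.
have NZ : N%:Z != 0 :> int by lia.
have [y yE] : exists y : nat, (x %% N)%Z = y%:Z.
  by exists `|(x %% N)%Z|%N; have := modz_ge0 x NZ; lia.
(* km is an inverse of M modulo N. *)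
exists ((y * km) %% N)%N; first by rewrite ltn_mod.
exists ((x %/ N)%Z + M%:Z * ((y * km) %/ N)%N%:Z - y%:Z * kn%:Z).
have eM : ((y * km) %% N)%N%:Z = y%:Z * km%:Z - N%:Z * ((y * km) %/ N)%N%:Z.
  by have := divn_eq (y * km) N; nia.
have eZ : km%:Z * M%:Z = kn%:Z * N%:Z + 1 by lia.
have := divz_eq x N; rewrite yE eM => {1}->.
have -> : M%:Z * (y%:Z * km%:Z - N%:Z * ((y * km) %/ N)%N%:Z) =
  y%:Z * (km%:Z * M%:Z) - M%:Z * N%:Z * ((y * km) %/ N)%N%:Z by ring.
by rewrite eZ; ring.
Qed.

Lemma coprime_dvdZ (N M k : nat) (z : int) : coprime N M ->
  k%:Z * M%:Z = N%:Z * z -> (N %| k)%N.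
Proof.
move=> cNM e.
have : (N %| k * M)%N by apply/dvdnP; exists `|z|%N; nia.
by rewrite Gauss_dvdl.
Qed.

End Arithmetic.

(** The insertion point of a rim and the place where it can be cut out are both
last indices with some property. *)
Lemma exists_last (P : nat -> Prop) (i N : nat) : i <= N -> P i ->
  exists j, [/\ i <= j <= N, P j & forall k, j < k <= N -> ~ P k].
Proof.
elim: N => [|N IH] iN Pi.
  by exists i; split=> // [|k]; lia.
have [PN|nPN] := pselect (P N.+1).
  by exists N.+1; split=> // [|k]; lia.
have [iN1|iN1] := eqVneq i N.+1; first by rewrite iN1 in Pi.
have [|j [jN Pj last_j]] := IH _ Pi; first lia.
exists j; split=> //; first lia.
move=> k jk; have [->//|kN] := eqVneq k N.+1.
by apply: last_j; lia.
Qed.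

(** * Patterns and their vertical runs *)

Section Patterns.

(** The empty list gets column 0 because a path starts there. *)
Definition column (T : Type) (st : seq (nat * T)) : nat :=
  if st is (x, _) :: _ then x else 0.

(** The inequality is strict because two runs in the same column would be one. *)
Definition opens (T : Type) (st : seq (nat * T)) (x : nat) : bool :=
  if st is (y, _) :: _ then y < x else true.

(** Lists of runs, given by column and length, have the latest run first, so that
one more step of a path only affects the head.  The east steps behind the last
run are not part of the pattern of a list. *)
Fixpoint pattern (pv : seq (nat * nat)) : seq step :=
  if pv is (x, v) :: pv' then
    pattern pv' ++ nseq (x - column pv') east ++ nseq v south
  else [::].

Variables d s : nat.

(** The third conjunct is the diagonal condition at the upper end of the run; at
the other points of the run and on the east steps before it, the condition is
weaker. *)
Fixpoint run_list (pv : seq (nat * nat)) : bool :=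
  if pv is (x, v) :: pv' then
    [&& 0 < v, opens pv' x, d * x <= s * sumn (unzip2 pv') & run_list pv']
  else true.

Lemma opens_column (T : Type) (st : seq (nat * T)) x : opens st x -> column st <= x.
Proof. by case: st => //= -[y t] _ /ltnW. Qed.

Lemma south_pattern pv : count_mem south (pattern pv) = sumn (unzip2 pv).
Proof.
elim: pv => //= -[x v] pv IH; rewrite !count_cat IH !count_nseq /= mul0n mul1n.
by rewrite addnC.
Qed.

Lemma east_pattern pv : run_list pv -> count_mem east (pattern pv) = column pv.
Proof.
elim: pv => //= -[x v] pv IH /= /and4P[_ op _ /IH e].
by rewrite !count_cat e !count_nseq /= mul0n mul1n addn0 subnKC // opens_column.
Qed.

Lemma vruns_from_cat k P Q :
  vruns_from k (P ++ east :: Q) = vruns_from k P ++ vruns_from 0 Q.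
Proof.
elim: P k => [|[] P IH] [|k] //=; rewrite ?IH //.
Qed.

Lemma vruns_from_east e Q : vruns_from 0 (nseq e east ++ Q) = vruns_from 0 Q.
Proof. by elim: e. Qed.

Lemma vruns_from_south k v : 0 < v -> vruns_from k (nseq v south) = [:: k + v].
Proof.
case: v => // v _; elim: v k => [|v IH] k; first by rewrite addn1.
rewrite -[nseq v.+2 _]/(south :: nseq v.+1 south) /= in IH *.
by rewrite IH; congr [:: _]; lia.
Qed.

(** Increasing columns put an east step between consecutive runs, so that these
are maximal. *)
Lemma vruns_pattern pv e : run_list pv ->
  vruns (pattern pv ++ nseq e east) = rev (unzip2 pv).
Proof.
have vruns_trail P e' : vruns (P ++ nseq e' east) = vruns P.
  case: e' => [|e']; first by rewrite cats0.
  have e0 : vruns_from 0 (nseq e' east) = [::] by elim: e'.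
  by rewrite /vruns /= vruns_from_cat e0 cats0.
rewrite {}vruns_trail; elim: pv => //= -[x v] pv IH /= /and4P[v0 op _ rl].
rewrite rev_cons -cats1 -(IH rl); case: pv {IH} op rl => [|[y w] pv] op rl.
  by rewrite /= /vruns vruns_from_east vruns_from_south.
rewrite /= in op; rewrite /vruns -[x - _]prednK /=; last by rewrite subn_gt0.
by rewrite vruns_from_cat vruns_from_east vruns_from_south.
Qed.

Definition below (P : seq step) : Prop := forall k, k <= size P ->
  d * count_mem east (take k P) <= s * count_mem south (take k P).

Lemma below_rcons P st : below (rcons P st) <->
  below P /\ d * count_mem east (rcons P st) <= s * count_mem south (rcons P st).
Proof.
split=> [b|[b le] k].
  split=> [k kP|].
    have := b k; rewrite size_rcons -cats1 takel_cat //; apply; lia.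
  by have := b (size (rcons P st)) (leqnn _); rewrite take_size.
rewrite size_rcons leq_eqVlt => /orP[/eqP->|kP].
  by rewrite -(size_rcons P st) take_size.
by rewrite -cats1 takel_cat //; apply: b.
Qed.

Lemma below_pattern pv e : run_list pv -> d * (column pv + e) <= s * sumn (unzip2 pv) ->
  below (pattern pv ++ nseq e east).
Proof.
have easts P e' : below P ->
    d * (count_mem east P + e') <= s * count_mem south P -> below (P ++ nseq e' east).
  elim: e' => [|e' IH] bP le; first by rewrite cats0.
  rewrite -addn1 nseqD catA cats1 below_rcons.
  split; first by apply: IH => //; apply: leq_trans le; rewrite leq_mul2l; lia.
  rewrite -cats1 !count_cat !count_nseq /=; move: le.
  by rewrite mul1n mul0n !addn0 addnS addn1.
have souths P v : below P -> below (P ++ nseq v south).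
  elim: v => [|v IH] bP; first by rewrite cats0.
  rewrite -addn1 nseqD catA cats1 below_rcons; have bv := IH bP; split=> //.
  have := bv _ (leqnn _); rewrite take_size; move: (P ++ _) => Q leQ.
  rewrite -cats1 !count_cat /= !addn0; apply: (leq_trans leQ).
  by rewrite leq_mul2l leq_addr orbT.
move=> rl le; apply: (easts _ _); last by rewrite east_pattern // south_pattern.
elim: pv rl {le} => [|[x v] pv IH] /=; first by move=> _ k _; rewrite !muln0.
move=> /and4P[_ op le /[dup] rl /IH bp]; rewrite catA.
apply: (souths _ _); apply: (easts _ _) => //.
by rewrite east_pattern // south_pattern subnKC // opens_column.
Qed.

(** By induction on the last step: an east step increases e; a south step prolongs
the last run if e = 0 and opens a new one if not. *)
Lemma below_is_pattern P : below P ->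
  exists pv e, run_list pv /\ P = pattern pv ++ nseq e east.
Proof.
elim/last_ind: P => [|P st IH]; first by exists [::], 0.
move=> /below_rcons[bP le]; have [pv [e [rl PE]]] := IH bP.
case: st le => le; last first.
  exists pv, e.+1; split=> //.
  by rewrite PE -cats1 -catA -[[:: _]]/(nseq 1 east) -nseqD addn1.
have cE : count_mem east P = column pv + e.
  by rewrite PE count_cat east_pattern // count_nseq mul1n.
have cS : count_mem south P = sumn (unzip2 pv).
  by rewrite PE count_cat south_pattern count_nseq mul0n addn0.
have leP : d * (column pv + e) <= s * sumn (unzip2 pv).
  by rewrite -cE -cS; have := bP _ (leqnn _); rewrite take_size.
have new : opens pv (column pv + e) ->
    exists pv' e', run_list pv' /\ rcons P south = pattern pv' ++ nseq e' east.
  move=> op; exists ((column pv + e, 1) :: pv), 0; split; first by rewrite /= op leP.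
  by rewrite cats0 /= addKn catA -PE cats1.
case: e pv {IH bP} rl PE cE cS leP new => [|e] [|[x v] pv] rl PE cE cS leP new;
  try by apply: new; rewrite //= -addSnnS ltn_addr.
exists ((x, v.+1) :: pv), 0; split; first by move: rl => /= /and3P[_ -> ->].
have patternE w : pattern ((x, w) :: pv) =
  pattern pv ++ nseq (x - column pv) east ++ nseq w south by [].
by rewrite PE !cats0 -cats1 !patternE -addn1 nseqD !catA.
Qed.

(** The last south step separates the e final east steps; without them and the
last run, the words of the two shorter lists remain. *)
Lemma pattern_inj pv pv' e e' : run_list pv -> run_list pv' ->
    unzip2 pv = unzip2 pv' ->
    pattern pv ++ nseq e east = pattern pv' ++ nseq e' east ->
  pv = pv'.
Proof.
elim: pv pv' e e' => [|[x v] pv IH] [|[x' v'] pv'] e e' //=.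
move=> /and4P[v0 op _ rl] /and4P[v'0 op' _ rl'] [ev epv'] ep; subst v'.
have catIr (T : Type) (t1 t2 t : seq T) : t1 ++ t = t2 ++ t -> t1 = t2.
  move=> e12; have st : size t1 = size t2.
    by have := congr1 size e12; rewrite !size_cat => /addIn.
  by have := congr1 (take (size t1)) e12; rewrite take_size_cat // st take_size_cat.
case: v v0 ep {v'0} => // v _; rewrite -[v.+1]addn1 nseqD -!catA /=.
rewrite !catA => /eqP; rewrite eqseq_pivot2r ?mem_nseq ?andbF // => /andP[/eqP eP _].
move: eP => /catIr eP.
have epv := IH _ _ _ rl rl' epv' eP; subst pv'.
have := congr1 size eP; rewrite !size_cat !size_nseq => /addnI exx.
have := opens_column op; have := opens_column op' => ? ?.
by have -> : x = x' by lia.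
Qed.

End Patterns.

(** * Stacks of excursions encode cabled Dyck paths *)

Section Stacks.
Import Order.TTheory Num.Theory.
Local Open Scope ring_scope.
Variables n m d s : nat.
Local Notation L := (n + m)%N.

Lemma size_steps (p : seq step) :
  size p = count_mem south p + count_mem east p.
Proof.
by rewrite -(count_predC (pred1 south)); congr addn; apply: eq_count; case.
Qed.

Definition stride (st : step) : int := if st == south then m%:Z else - n%:Z.

(** With these weights of the steps the diagonal condition for a
(v n, v m)-Dyck path reads 0 <= rise, for all v at once. *)
Definition rise (p : seq step) : int :=
  m%:Z * (count_mem south p)%:Z - n%:Z * (count_mem east p)%:Z.

Lemma rise_nil : rise [::] = 0.
Proof. by rewrite /rise /= !mulr0 subrr. Qed.

Lemma rise_cat p q : rise (p ++ q) = rise p + rise q.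
Proof. by rewrite /rise !count_cat; lia. Qed.

Lemma rise_cons st p : rise (st :: p) = stride st + rise p.
Proof. by rewrite /rise /stride /=; case: st => /=; lia. Qed.

(** The weights m and -n agree modulo L, so modulo L the rise only depends on the
number of steps. *)
Lemma rise_size p : rise p = m%:Z * (size p)%:Z - L%:Z * (count_mem east p)%:Z.
Proof.
by rewrite /rise size_steps PoszD; ring.
Qed.

Definition excursion (p : seq step) : Prop :=
  (forall i, 0 <= rise (take i p)) /\ rise p = 0.

Definition runs (st : seq (nat * seq step)) : seq (nat * nat) :=
  [seq (xp.1, size xp.2 %/ L)%N | xp <- st].

Definition loops (st : seq (nat * seq step)) : nat := sumn (unzip2 (runs st)).

(** An entry (x, p) stands for a vertical run in column x with cabling path p; the
length of the run is encoded in the size of p.  The latest run comes first. *)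
Fixpoint path_stack (st : seq (nat * seq step)) : Prop :=
  if st is (x, p) :: st' then
    [/\ excursion p /\ exists v, size p = (v.+1 * L)%N, opens st' x,
        (d * x <= s * loops st')%N & path_stack st']
  else True.

Hypothesis n_gt0 : (0 < n)%N.
Hypothesis m_gt0 : (0 < m)%N.
Hypothesis d_gt0 : (0 < d)%N.

(** A vanishing rise forces the south and east steps into the ratio n : m, and then
the size determines both numbers. *)
Lemma excursion_dyck v p :
  excursion p /\ size p = (v.+1 * L)%N <-> dyck_path (v.+1 * n) (v.+1 * m) p.
Proof.
have le_rise k : (v.+1 * n * count_mem east (take k p) <=
    v.+1 * m * count_mem south (take k p))%N = (0 <= rise (take k p)).
  by rewrite -!mulnA leq_pmul2l // /rise subr_ge0 -!PoszM lez_nat.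
have sz := size_steps p; split=> [[[p0 p_end] sp]|[cS cE b]].
  have e : (m * count_mem south p = n * count_mem east p)%N.
    by move: p_end; rewrite /rise; lia.
  have L_gt0 : (0 < L)%N by lia.
  have cS : count_mem south p = (v.+1 * n)%N.
    apply/eqP; rewrite -(eqn_pmul2l L_gt0); apply/eqP.
    have -> : (L * count_mem south p = n * size p)%N by rewrite sz mulnDl e; lia.
    by rewrite sp; lia.
  split=> //; last by move=> k _; rewrite le_rise.
  by move: sz; rewrite sp cS; lia.
split; last by rewrite sz cS cE mulnDr.
split=> [i|]; last by rewrite /rise cS cE; lia.
have [ip|pi] := leqP i (size p); first by rewrite -le_rise b.
by rewrite take_oversize ?(ltnW pi) // /rise cS cE; lia.
Qed.

Lemma opens_runs st x : opens (runs st) x = opens st x.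
Proof. by case: st => [|[]]. Qed.

Lemma column_runs st : column (runs st) = column st.
Proof. by case: st => [|[]]. Qed.

Lemma path_stackE st : path_stack st <-> run_list d s (runs st) /\
  forall q, q \in unzip2 st -> excursion q /\ (L %| size q)%N.
Proof.
have L_gt0 : (0 < L)%N by lia.
elim: st => [|[x p] st IH]; first by split.
rewrite /= opens_runs -/(loops st); split.
  move=> [[hp [v sp]] op bx /IH[rl hst]]; rewrite op bx rl sp mulnK //.
  split=> // q; rewrite inE => /orP[/eqP->|]; last exact: hst.
  by rewrite sp dvdn_mull.
move=> [/and4P[v0 op bx rl] hst]; split=> //.
  have [|hp dv] := hst p; first by rewrite inE eqxx.
  by split=> //; exists (size p %/ L).-1%N; rewrite prednK // divnK.
by apply/IH; split=> // q qst; apply: hst; rewrite inE qst orbT.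
Qed.

Definition cabled_code (st : seq (nat * seq step)) : seq step * seq (seq step) :=
  (pattern (runs st) ++ nseq (s - column st) east, rev (unzip2 st)).

Lemma column_le st : path_stack st -> loops st = d -> (column st <= s)%N.
Proof.
case: st => [|[x p] st] //= [_ _ bx _] ld; rewrite -(leq_pmul2l d_gt0).
apply: (leq_trans bx); rewrite mulnC leq_mul2r -ld; apply/orP; right.
by rewrite /loops /= leq_addl.
Qed.

Lemma sizes_runs st :
  [seq size q %/ L | q <- rev (unzip2 st)]%N = rev (unzip2 (runs st)).
Proof. by rewrite map_rev /unzip2 /runs -!map_comp. Qed.

Lemma cabled_code_in st : path_stack st -> loops st = d ->
  cabled_dyck_paths n m d s (cabled_code st).
Proof.
have L_gt0 : (0 < L)%N by lia.
move=> vs ld; have col := column_le vs ld.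
have [rl hst] := (path_stackE st).1 vs.
rewrite /cabled_dyck_paths /= (vruns_pattern _ rl) -sizes_runs; split.
- split.
  + by rewrite count_cat south_pattern count_nseq mul0n addn0.
  + by rewrite count_cat (east_pattern rl) count_nseq mul1n column_runs subnKC.
  + by apply: below_pattern rl _; rewrite column_runs subnKC // -/(loops st) ld mulnC.
- by rewrite size_map.
move=> i; rewrite size_map => ist; rewrite (nth_map [::]) //.
set q := nth _ _ _; have qst : q \in unzip2 st by rewrite -mem_rev mem_nth.
have [hq dv] := hst q qst.
have q0 : (0 < size q %/ L)%N.
  have : (size q %/ L)%N \in unzip2 (runs st).
    rewrite /unzip2 /runs -map_comp; move: qst => /mapP[xp xpst ->].
    by apply/mapP; exists xp.
  have pos pv : run_list d s pv -> all (leq 1) (unzip2 pv).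
    by elim: pv => //= -[x v] pv IH /and4P[-> _ _ /IH].
  by move=> vst; apply: (allP (pos _ rl)).
by rewrite -(prednK q0); apply/excursion_dyck; rewrite prednK // divnK.
Qed.

(** The pattern provides the columns, and the cabling paths are attached to them
by position. *)
Lemma cabled_code_onto PQ : cabled_dyck_paths n m d s PQ ->
  exists st, [/\ path_stack st, loops st = d & cabled_code st = PQ].
Proof.
have L_gt0 : (0 < L)%N by lia.
case: PQ => P qs [/= [cS cE bP] sq hq].
have [pv [e [rl PE]]] := below_is_pattern bP.
have vE : vruns P = rev (unzip2 pv) by rewrite PE (vruns_pattern _ rl).
have pos v : v \in unzip2 pv -> (0 < v)%N.
  elim: pv rl {PE vE} => //= -[x w] pv IH /and4P[w0 _ _ /IH{}IH].
  by rewrite inE => /orP[/eqP->|].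
have hq' i : (i < size qs)%N -> excursion (nth [::] qs i) /\
    size (nth [::] qs i) = (nth 0 (vruns P) i * L)%N.
  rewrite sq => ist; have := hq i ist.
  have w0 : (0 < nth 0 (vruns P) i)%N by apply: pos; rewrite -mem_rev -vE mem_nth.
  by rewrite -(prednK w0) => /excursion_dyck.
have sizes : [seq size q %/ L | q <- qs]%N = vruns P.
  apply: (@eq_from_nth _ 0%N) => [|i]; rewrite size_map // => ist.
  by rewrite (nth_map [::]) // (hq' i ist).2 mulnK.
have szip : size (unzip1 pv) = size (rev qs).
  by rewrite size_rev sq vE size_rev !size_map.
pose st := zip (unzip1 pv) (rev qs).
have st1 : unzip1 st = unzip1 pv by rewrite unzip1_zip // szip.
have st2 : unzip2 st = rev qs by rewrite unzip2_zip // szip.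
have rst : runs st = pv.
  rewrite -(zip_unzip (runs st)) -(zip_unzip pv); congr zip.
    by rewrite -st1 /unzip1 /runs -map_comp.
  rewrite -[LHS]revK -sizes_runs st2 revK sizes vE revK //.
have lst : loops st = d.
  by rewrite /loops rst -cS PE count_cat south_pattern count_nseq mul0n addn0.
have vs : path_stack st.
  apply/path_stackE; rewrite rst st2; split=> // q.
  rewrite mem_rev => /(nthP [::])[i ist <-]; have [hi ->] := hq' i ist.
  by rewrite dvdn_mull.
exists st; split=> //; rewrite /cabled_code st2 revK rst; congr (_, _).
rewrite PE; congr (_ ++ nseq _ _).
by move: cE; rewrite PE count_cat (east_pattern rl) count_nseq mul1n -column_runs rst; lia.
Qed.

Lemma cabled_code_inj st st' : path_stack st -> path_stack st' ->
  cabled_code st = cabled_code st' -> st = st'.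
Proof.
move=> /path_stackE[rl _] /path_stackE[rl' _] [eP eQ].
have e2 : unzip2 st = unzip2 st' by rewrite -[LHS]revK eQ revK.
have er2 : unzip2 (runs st) = unzip2 (runs st').
  by apply: (can_inj revK); rewrite -!sizes_runs e2.
have er := pattern_inj rl rl' er2 eP.
rewrite -(zip_unzip st) -(zip_unzip st') e2; congr zip.
have e1 st0 : unzip1 st0 = unzip1 (runs st0) by rewrite /unzip1 /runs -map_comp.
by rewrite e1 er -e1.
Qed.

End Stacks.

(** * Semimodules, Apéry sets and rims *)

Section Cabling.
Import Order.TTheory Num.Theory.
Local Open Scope ring_scope.
Variables n m d s : nat.
Local Notation L := (n + m)%N.
Local Notation stride := (stride n m).
Local Notation rise := (rise n m).
Local Notation excursion := (excursion n m).
Local Notation loops := (loops n m).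
Local Notation path_stack := (path_stack n m d s).

(** A bounded below module over the numerical semigroup generated by n and m. *)
Definition semimodule (D : set int) : Prop :=
  [/\ forall x, D x -> D (x + n%:Z), forall x, D x -> D (x + m%:Z),
      exists x, D x & exists b, forall x, D x -> b <= x].

(** For a semimodule these are the least elements of D in the classes modulo L, its
Apéry set. *)
Definition apery (D : set int) (a : int) : Prop := D a /\ ~ D (a - L%:Z).

(** In terms of rims: the rim of E is not strictly above the rim of D. *)
Definition meets (D E : set int) : Prop := exists2 a, apery D a & E a.

(** The walk through the Apéry set of D that starts at a: since m and -n agree
modulo L, one of a - n and a + m is the Apéry element of the next class. *)
Fixpoint rim (D : set int) (a : int) (k : nat) : seq step :=
  if k is k'.+1 then
    let st := if `[< D (a - n%:Z) >] then east else south in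
    st :: rim D (a + stride st) k'
  else [::].

Lemma semimoduleL D : semimodule D -> forall x, D x -> D (x + L%:Z).
Proof.
by move=> [Dn Dm _ _] x Dx; rewrite PoszD addrA; apply/Dm/Dn.
Qed.

Lemma semimoduleLM D x (k : nat) : semimodule D -> D x -> D (x + L%:Z * k%:Z).
Proof.
move=> hD Dx; elim: k => [|k IH]; first by rewrite mulr0 addr0.
have -> : x + L%:Z * k.+1%:Z = x + L%:Z * k%:Z + L%:Z by lia.
exact: semimoduleL.
Qed.

Lemma semimodule_le D x y (q : int) : semimodule D -> D x -> x <= y ->
  y = x + L%:Z * q -> D y.
Proof.
move=> hD Dx xy e; have [q0|q0] := lerP 0 q.
  by rewrite e -(gez0_abs q0); apply: semimoduleLM.
have : 0 <= L%:Z * - q by apply: mulr_ge0; lia.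
by rewrite mulrN => ?; have -> : y = x by lia.
Qed.

Lemma semimodule_min D : semimodule D ->
  exists2 x, D x & forall y, D y -> x <= y.
Proof.
move=> [_ _ [y Dy] [b Db]].
have [k [_ nk kmax]] : exists k, [/\ (0 <= k <= `|y - b|.+1)%N, D (y - k%:Z)
    & forall k', (k < k' <= `|y - b|.+1)%N -> ~ D (y - k'%:Z)].
  by apply: (exists_last (P := fun k => D (y - k%:Z)) (leq0n _)); rewrite subr0.
exists (y - k%:Z) => // z Dz; have [//|zk] := lerP (y - k%:Z) z.
case: (kmax `|y - z|%N); have := Db _ Dz; first lia.
by have -> : y - `|y - z|%N%:Z = z by lia.
Qed.

Lemma apery_mem D a x (q : int) : semimodule D -> apery D a ->
  x = a + L%:Z * q -> D x <-> a <= x.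
Proof.
move=> hD [Da nDa] e; split=> [Dx|ax]; last exact: semimodule_le Da ax e.
have [//|xa] := lerP a x; case: nDa.
have q_lt0 : q < 0.
  by case: (ltrP q 0) => // q0; have := mulr_ge0 (le0z_nat L) q0; lia.
have := @mulr_ge0 _ L%:Z (- q - 1) (le0z_nat L) => h.
by apply: (semimodule_le (q := - q - 1) hD Dx); lia.
Qed.

Lemma apery_uniq D a b (q : int) : semimodule D -> apery D a -> apery D b ->
  b = a + L%:Z * q -> a = b.
Proof.
move=> hD aA aB e.
have ab : a <= b by apply/(apery_mem hD aA e); case: aB.
have ba : b <= a by apply/(apery_mem (q := - q) hD aB); [lia | case: aA].
lia.
Qed.

(** If a - n is in D, then a - n - L is not, for otherwise a - L would be.  If a - n
is not in D, it is the element L below a + m. *)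
Lemma apery_step D a : semimodule D -> apery D a ->
  apery D (a + stride (if `[< D (a - n%:Z) >] then east else south)).
Proof.
move=> hD [Da nDa]; have [Dn Dm _ _] := hD.
case: asboolP => h; split=> //=; rewrite /stride /=.
- by move=> /Dn; have -> : a - n%:Z - L%:Z + n%:Z = a - L%:Z by lia.
- exact: Dm.
- by have -> : a + m%:Z - L%:Z = a - n%:Z by lia.
Qed.

Lemma size_rim D a k : size (rim D a k) = k.
Proof. by elim: k a => //= k IH a; rewrite IH. Qed.

Lemma take_rim D a j k : (j <= k)%N -> take j (rim D a k) = rim D a j.
Proof.
elim: k a j => [|k IH] a [|j] //= jk.
by rewrite IH.
Qed.

Lemma apery_rim D a k : semimodule D -> apery D a -> apery D (a + rise (rim D a k)).
Proof.
move=> hD; elim: k a => [|k IH] a aA.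
  by rewrite rise_nil addr0.
rewrite /= rise_cons addrA; apply: IH; exact: apery_step.
Qed.

(** After L steps the walk is back in the class of a, which has only one Apéry
element. *)
Lemma rise_rim D a : semimodule D -> apery D a -> rise (rim D a L) = 0.
Proof.
move=> hD aA; have aB := apery_rim L hD aA.
set w := rim D a L in aB *.
have e : a + rise w = a + L%:Z * (m%:Z - (count_mem east w)%:Z).
  by rewrite rise_size size_rim; ring.
have := apery_uniq hD aA aB e; lia.
Qed.

(** * Heights along a path *)

Definition height (b : int) (p : seq step) (i : nat) : int := b + rise (take i p).

Lemma height_catl b p q i : (i <= size p)%N -> height b (p ++ q) i = height b p i.
Proof. by move=> ip; rewrite /height takel_cat. Qed.

Lemma height_catr b p q j : height b (p ++ q) (size p + j) = height (b + rise p) q j.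
Proof.
by rewrite /height take_cat ltnNge leq_addr /= addKn rise_cat addrA.
Qed.

Lemma height_over b p i : (size p <= i)%N -> height b p i = b + rise p.
Proof. by move=> ip; rewrite /height take_oversize. Qed.

Lemma heightS b p i : (i < size p)%N ->
  height b p i.+1 = height b p i + stride (nth east p i).
Proof.
move=> ip; rewrite /height (take_nth east) // -cats1 rise_cat rise_cons rise_nil.
by rewrite addr0 addrA.
Qed.

Lemma height_mod b p i : (i <= size p)%N ->
  exists q : int, height b p i = b + m%:Z * i%:Z + L%:Z * q.
Proof.
move=> ip; exists (- (count_mem east (take i p))%:Z).
by rewrite /height rise_size size_takel //; ring.
Qed.

Lemma height_loop b p D i j : semimodule D -> apery D (height b p i) ->
    (i + L <= size p)%N -> take L (drop i p) = rim D (height b p i) L ->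
  (j <= L)%N -> height b p (i + j) = height b p i + rise (rim D (height b p i) j).
Proof.
move=> hD aA iLp e jL; rewrite {1}/height.
have -> : take (i + j) p = take i p ++ take j (drop i p) by rewrite takeD.
rewrite rise_cat addrA; congr (_ + rise _).
by rewrite -(take_rim _ _ jL) -e take_takel.
Qed.

Lemma excursion_height b p i : excursion p -> b <= height b p i.
Proof. by move=> [p0 _]; rewrite /height lerDl. Qed.

Definition insert_at i (w p : seq step) := take i p ++ w ++ drop i p.

Definition cut_at i (p : seq step) := take i p ++ drop (i + L) p.

Lemma size_insert_at i w p : size (insert_at i w p) = (size p + size w)%N.
Proof. by rewrite /insert_at !size_cat addnCA -size_cat cat_take_drop addnC. Qed.

Lemma cut_insert i w p : (i <= size p)%N -> size w = L ->
  cut_at i (insert_at i w p) = p.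
Proof.
move=> ip sw; have si : size (take i p) = i by rewrite size_takel.
rewrite /cut_at /insert_at take_cat si ltnn subnn take0 cats0.
by rewrite drop_cat si ltnNge leq_addr /= addKn drop_cat sw ltnn subnn drop0
  cat_take_drop.
Qed.

Lemma insert_cut i p : insert_at i (take L (drop i p)) (cut_at i p) = p.
Proof.
rewrite /cut_at /insert_at; have [ip|pi] := leqP i (size p).
  have si : size (take i p) = i by rewrite size_takel.
  rewrite take_cat si ltnn subnn take0 cats0 drop_cat si ltnn subnn drop0.
  by rewrite (addnC i) -drop_drop cat_take_drop cat_take_drop.
have e1 : take i p = p by rewrite take_oversize // ltnW.
have e2 : drop i p = [::] by rewrite drop_oversize // ltnW.
have e3 : drop (i + L) p = [::] by rewrite drop_oversize //; lia.
by rewrite e1 e2 e3 cats0 e1 e2 !cats0.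
Qed.

Lemma height_insert_before b i w p j : (i <= size p)%N -> (j <= i)%N ->
  height b (insert_at i w p) j = height b p j.
Proof.
move=> ip ji; rewrite height_catl ?size_takel //.
by rewrite /height take_takel.
Qed.

Lemma height_insert_in b i w p j : (i <= size p)%N -> (j <= size w)%N ->
  height b (insert_at i w p) (i + j) = height b p i + rise (take j w).
Proof.
move=> ip jw; rewrite -{2}(size_takel ip) height_catr height_catl //.
Qed.

Lemma height_insert_after b i w p j : (i <= size p)%N -> rise w = 0 ->
  (i <= j)%N -> height b (insert_at i w p) (j + size w) = height b p j.
Proof.
move=> ip w0 ij; have -> : (j + size w = size (take i p ++ w) + (j - i))%N.
  by rewrite size_cat size_takel //; lia.
rewrite /insert_at catA height_catr rise_cat w0 addr0.
transitivity (height b (take i p ++ drop i p) (size (take i p) + (j - i))).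
  by rewrite height_catr.
by rewrite cat_take_drop size_takel // subnKC.
Qed.

(** * The rim determines the semimodule *)

Hypothesis n_gt0 : (0 < n)%N.
Hypothesis m_gt0 : (0 < m)%N.
Hypothesis coprime_nm : coprime n m.

Lemma coprime_Lm : coprime L m.
Proof. by rewrite coprime_sym /coprime gcdnDr gcdnC. Qed.

(** As m is invertible modulo L, the walk visits all classes. *)
Lemma rim_cover D a x : exists2 j, (j < L)%N & exists q : int,
  x = a + rise (rim D a j) + L%:Z * q.
Proof.
have [|j jL [q e]] := coprime_combination (x - a) _ coprime_Lm; first lia.
exists j => //; exists (q + (count_mem east (rim D a j))%:Z).
rewrite rise_size size_rim.
have -> : x = a + (x - a) by lia.
by rewrite e; ring.
Qed.

Lemma apery_exists D x : semimodule D ->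
  exists2 a, apery D a & exists q : int, x = a + L%:Z * q.
Proof.
move=> hD; have [_ _ [y Dy] [b Db]] := hD.
have [k [_ nk kmax]] : exists k, [/\ (0 <= k <= `|y - b|.+1)%N, D (y - L%:Z * k%:Z)
    & forall k', (k < k' <= `|y - b|.+1)%N -> ~ D (y - L%:Z * k'%:Z)].
  by apply: (exists_last (leq0n _)); rewrite mulr0 subr0.
have aA : apery D (y - L%:Z * k%:Z).
  split=> //.
  have -> : y - L%:Z * k%:Z - L%:Z = y - L%:Z * k.+1%:Z by lia.
  have [kN|kN] := leqP k `|y - b|; first by apply: kmax; lia.
  by move=> /Db; have := leq_pmull k.+1 (ltn_addr m n_gt0); lia.
have [j _ [q e]] := rim_cover D (y - L%:Z * k%:Z) x.
by exists (y - L%:Z * k%:Z + rise (rim D (y - L%:Z * k%:Z) j));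
  [exact: apery_rim | exists q].
Qed.

Lemma rim_apery D a x : semimodule D -> apery D a -> apery D x ->
  exists2 j, (j < L)%N & x = a + rise (rim D a j).
Proof.
move=> hD aA xA; have [j jL [q' e]] := rim_cover D a x.
by exists j => //; rewrite -(apery_uniq hD (apery_rim j hD aA) xA e).
Qed.

(** Membership of x is decided by comparing x with the Apéry element of its class,
which is a point of the rim. *)
Lemma rim_inj D E a : semimodule D -> semimodule E -> apery D a -> apery E a ->
  rim D a L = rim E a L -> D = E.
Proof.
move=> hD hE aD aE e; apply/funext => x; apply/propext.
have [j jL [q xE]] := rim_cover D a x.
have e_j : rim D a j = rim E a j.
  by rewrite -(take_rim D a (ltnW jL)) e take_rim // ltnW.
have := apery_mem hD (apery_rim j hD aD) xE.
rewrite e_j in xE *.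
by have := apery_mem hE (apery_rim j hE aE) xE; tauto.
Qed.

Lemma semimodule_large D : semimodule D -> exists B : nat, forall x, B%:Z <= x -> D x.
Proof.
move=> hD; have [_ _ [y Dy] _] := hD; have [a aA _] := apery_exists y hD.
exists (`|a| + m * L)%N => x Bx.
have [j jL [q e]] := rim_cover D a x; have aj := apery_rim j hD aA.
apply/(apery_mem hD aj e); rewrite rise_size size_rim.
have : (m * j <= m * L)%N by rewrite leq_mul2l (ltnW jL) orbT.
have := mulr_ge0 (le0z_nat L) (le0z_nat (count_mem east (rim D a j))).
by lia.
Qed.

(** An n-generator a of D gives the Apéry element a + m.  For the converse, follow
the rim of D backwards from an Apéry element that lies in E: undoing a step -n
adds n and stays in E; the first step +m that is met starts at an n-generator. *)
Lemma meets_generatorP D E : semimodule D -> semimodule E ->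
  meets D E <-> exists a, [/\ D a, ~ D (a - n%:Z) & E (a + m%:Z)].
Proof.
move=> hD hE; have [Dn Dm _ _] := hD; have [En Em _ _] := hE; split; last first.
  move=> [a [Da nDa Ea]]; exists (a + m%:Z) => //; split; first exact: Dm.
  by have -> : a + m%:Z - L%:Z = a - n%:Z by lia.
move=> [a aA Ea]; have [B DB] := semimodule_large hD.
have [k Dk] : exists k : nat, D (a + n%:Z * k%:Z - m%:Z).
  exists (`|a| + m + B)%N; apply: DB.
  by have := leq_pmull (`|a| + m + B) n_gt0; lia.
elim: k a aA Ea Dk => [|k IH] a [Da nDa] Ea Dk.
  exists (a - m%:Z); split; last by rewrite addrNK.
    by move: Dk; rewrite mulr0 addr0.
  by have -> : a - m%:Z - n%:Z = a - L%:Z by lia.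
have [Dam|nDam] := pselect (D (a - m%:Z)).
  exists (a - m%:Z); split; rewrite ?addrNK //.
  by have -> : a - m%:Z - n%:Z = a - L%:Z by lia.
apply: (IH (a + n%:Z)); [split; first exact: Dn | exact: En |].
- by have -> : a + n%:Z - L%:Z = a - m%:Z by lia.
- by have -> : a + n%:Z + n%:Z * k%:Z - m%:Z = a + n%:Z * k.+1%:Z - m%:Z by lia.
Qed.

(** * Inserting a rim into a path and cutting it out *)

(** The path runs along the rim of D from index i on, and this is its last closed
subwalk of length L, the trace of the latest insertion. *)
Definition tail_loop b p D i : Prop :=
  [/\ semimodule D, (i + L <= size p)%N, apery D (height b p i),
      take L (drop i p) = rim D (height b p i) L
    & forall j, (i < j)%N -> (j + L <= size p)%N ->
        height b p (j + L) < height b p j].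

Definition last_visit b p (D : set int) i : Prop :=
  [/\ (i <= size p)%N, D (height b p i)
    & forall j, (i < j <= size p)%N -> ~ D (height b p j)].

(** Up to i + L the path stays in the Apéry set of D; after that, each height is
lower than the one L steps before, which belongs to the same class. *)
Lemma tail_loop_notin b p D i j : tail_loop b p D i ->
  (i <= j <= size p)%N -> ~ D (height b p j - L%:Z).
Proof.
move=> [hD iLp aA e dec]; elim/ltn_ind: j => j IH /andP[ij jp].
have [jiL|iLj] := leqP j (i + L).
  rewrite -(subnKC ij) (height_loop hD aA) //; last lia.
  by have [] := apery_rim (j - i) hD aA.
have Lj : (L <= j)%N by lia.
have := IH (j - L)%N _ _; have := dec (j - L)%N; rewrite subnK // => lt_h nD.
have {}nD := nD _ _; move=> Dj; apply: nD; [lia|lia|].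
have {}lt_h : height b p j < height b p (j - L) by apply: lt_h; lia.
have [q e1] := height_mod b jp.
have [q' e2] : exists q : int, height b p (j - L) = b + m%:Z * (j - L)%N%:Z + L%:Z * q.
  by apply: height_mod; lia.
apply: (semimodule_le (q := q' - q - m%:Z) hD Dj); first lia.
by rewrite e1 e2 -subzn //; ring.
Qed.

(** A tail loop returns to its height after L steps, so its index cannot lie beyond
the index of another tail loop. *)
Lemma tail_loop_uniq b p D E i k : tail_loop b p D i -> tail_loop b p E k ->
  i = k /\ D = E.
Proof.
have le_ik D' E' i' k' : tail_loop b p D' i' -> tail_loop b p E' k' -> (k' <= i')%N.
  move=> [_ _ _ _ dec] [hE kLp aE e _]; rewrite leqNgt; apply/negP => ik.
  have := dec k' ik kLp; rewrite (height_loop hE aE) // rise_rim // addr0.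
  by rewrite ltxx.
move=> tD tE; have ik : i = k.
  by apply/eqP; rewrite eqn_leq (le_ik _ _ _ _ tD tE) (le_ik _ _ _ _ tE tD).
split=> //; case: tD => [hD _ aD eD _]; case: tE => [hE _ aE eE _].
by subst k; apply: (rim_inj hD hE aD aE); rewrite -eD -eE.
Qed.

Lemma tail_loop_bound b p D i : excursion p -> tail_loop b p D i ->
  forall y, D y -> b <= y.
Proof.
move=> hp [hD iLp aD e _] y Dy; have [a aA [q ye]] := apery_exists y hD.
have ay : a <= y by apply/(apery_mem hD aA ye).
have [j jL aj] := rim_apery hD aD aA.
apply: le_trans ay; rewrite aj -(height_loop hD aD) ?(ltnW jL) //.
exact: excursion_height.
Qed.

(** If height - L were in D, the next height would be in D as well, whatever the
step is; and at the end of the path height - L is below the bound b. *)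
Lemma last_visit_apery b p D i : semimodule D -> (forall y, D y -> b <= y) ->
  rise p = 0 -> last_visit b p D i -> apery D (height b p i).
Proof.
move=> hD Db p0 [ip Di last_i]; split=> // Dj.
have [Dn Dm _ _] := hD.
have [pi|ip'] := leqP (size p) i.
  by have := Db _ Dj; rewrite height_over // p0; lia.
apply: (last_i i.+1); first lia.
rewrite heightS // /stride; case: eqP => _; first exact: Dm.
by have := Dm _ Dj; congr D; lia.
Qed.

(** Since D meets E, some point of the tail loop of D is in E, so the last visit to
E does not come before that loop, and from there on the path descends in the
sense of tail_loop.  On the inserted loop the heights are least elements of E,
whereas the old path, at the same classes, is outside E and hence lower. *)
Lemma tail_loop_insert b p D E i k : excursion p -> tail_loop b p D i ->
    semimodule E -> (forall y, E y -> b <= y) -> meets D E -> last_visit b p E k ->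
  let p' := insert_at k (rim E (height b p k) L) p in
  excursion p' /\ tail_loop b p' E k.
Proof.
move=> hp tl hE Eb [a aD Ea] lv; have [hD iLp aA e dec] := tl.
have aE := last_visit_apery hE Eb hp.2 lv.
have [kp Ek last_k] := lv; set w := rim _ _ _ => p'.
have w0 : rise w = 0 by exact: rise_rim.
have sw : size w = L by rewrite size_rim.
have sp' : size p' = (size p + L)%N.
  by rewrite !size_cat sw size_takel // size_drop; lia.
have ik : (i <= k)%N.
  have [|ki] := leqP i k; first by [].
  have [j jL aj] := rim_apery hD aA aD; case: (last_k (i + j)%N); first lia.
  by rewrite (height_loop hD aA) -?aj // ltnW.
have h_in j : (j <= L)%N ->
    height b p' (k + j) = height b p k + rise (rim E (height b p k) j).
  by move=> jL; rewrite height_insert_in ?sw // take_rim.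
have h_after j : (k <= j)%N -> height b p' (j + L) = height b p j.
  by rewrite -sw; apply: height_insert_after.
split.
  split; last by rewrite /p' !rise_cat w0 add0r -rise_cat cat_take_drop; case: hp.
  move=> j; suff : b <= height b p' j by rewrite /height; lia.
  have [jk|kj] := leqP j k; first by rewrite height_insert_before // excursion_height.
  have [jkL|kLj] := leqP j (k + L).
    rewrite -(subnKC (ltnW kj)) h_in; last lia.
    by apply: Eb; case: (apery_rim (j - k) hE aE).
  by rewrite -(@subnK L j) ?h_after ?excursion_height //; lia.
have hk : height b p' k = height b p k by rewrite height_insert_before.
split=> //.
- by rewrite sp'; lia.
- by rewrite hk.
- rewrite hk /p' /insert_at drop_cat size_takel // ltnn subnn drop0.
  by rewrite -{1}sw take_size_cat.
move=> j kj jp; rewrite h_after; last lia.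
have jp' : (j <= size p)%N by lia.
(* The height at j + L is the old height at j; the one at j belongs to the
   inserted loop or is the old height at j - L. *)
have [jkL|kLj] := leqP j (k + L).
  have [|h] := ltrP (height b p j) (height b p' j); first by [].
  case: (last_k j); first lia.
  have [q e1] := height_mod b jp'.
  have [q' e2] : exists q : int, height b p' j = b + m%:Z * j%:Z + L%:Z * q.
    by apply: height_mod; lia.
  have Ej : E (height b p' j).
    rewrite -(subnKC (ltnW kj)) h_in; last lia.
    by case: (apery_rim (j - k) hE aE).
  by apply: (semimodule_le (q := q - q') hE Ej h); rewrite e1 e2; ring.
have Lj : (L <= j)%N by lia.
rewrite -{2}(subnK Lj) h_after; last lia.
by rewrite -{1}(subnK Lj); apply: dec; lia.
Qed.

(** The difference of the heights at j + L and at j is a multiple of L that changes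
by at most L when j grows by 1.  It is nonnegative for the first j and
nonpositive for the last one, hence zero at the last j where it is nonnegative.
The L heights from there on represent all classes modulo L and are the Apéry
set of the semimodule to be found. *)
Lemma tail_loop_exists b p : excursion p -> (L <= size p)%N ->
  exists D i, tail_loop b p D i.
Proof.
move=> hp Lp; pose h := height b p.
have h_b j : b <= h j by apply: excursion_height.
have h0 : h 0%N = b by rewrite /h /height take0 rise_nil addr0.
have h_end j : (size p <= j)%N -> h j = b.
  by move=> pj; rewrite /h height_over // hp.2 addr0.
have h_mod j : (j <= size p)%N -> exists q : int, h j = b + m%:Z * j%:Z + L%:Z * q.
  exact: height_mod.
have [i [/andP[_ iLp] i_up i_last]] : exists i, [/\ (0 <= i <= size p - L)%N,
    h i <= h (i + L)%N & forall j, (i < j <= size p - L)%N -> ~ (h j <= h (j + L)%N)].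
  by apply: (exists_last (P := fun j => h j <= h (j + L)%N) (leq0n _)); rewrite h0.
have {}iLp : (i + L <= size p)%N by lia.
have h_loop : h (i + L)%N = h i.
  have [ep|np] := eqVneq (i + L)%N (size p).
    have eb : h (i + L)%N = b by apply: h_end; rewrite ep.
    by have := h_b i; lia.
  have [|q1 e1] := h_mod i; first lia.
  have [q2 e2] := h_mod (i + L)%N iLp.
  have lt1 : (i < size p)%N by lia.
  have lt2 : (i + L < size p)%N by lia.
  have e3 := heightS b lt1; have e4 := heightS b lt2.
  (* If the difference at i were L or more, it would still be nonnegative
     at i + 1. *)
  have := i_last i.+1; rewrite addSn /h e3 e4 -/(h i) -/(h (i + L)%N) => H.
  have {}H := H (_ : (i < i.+1 <= size p - L)%N).
  have e5 : h (i + L)%N = h i + L%:Z * (m%:Z + q2 - q1) by rewrite e1 e2 PoszD; ring.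
  have [q0|q0] := lerP (m%:Z + q2 - q1) 0.
    have : 0 <= L%:Z * - (m%:Z + q2 - q1) by apply: mulr_ge0; lia.
    by rewrite mulrN; lia.
  have : 0 <= L%:Z * ((m%:Z + q2 - q1) - 1) by apply: mulr_ge0; lia.
  rewrite mulrBr mulr1 => q1_ge; case: H; first lia.
  by rewrite /stride; case: eqP => _; case: eqP => _; lia.
pose D : set int :=
  fun x => exists j k : nat, (j < L)%N /\ x = h (i + j)%N + L%:Z * k%:Z.
have L_gt0 : (0 < L)%N by lia.
have Dh j : (j <= L)%N -> D (h (i + j)%N).
  move=> jL; have [->|nj] := eqVneq j L.
    by exists 0%N, 0%N; rewrite h_loop addn0; split=> //; lia.
  by exists j, 0%N; split; [lia | rewrite mulr0 addr0].
have nDh' j : (j < L)%N -> ~ D (h (i + j)%N - L%:Z).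
  move=> jL [j' [k [j'L e]]].
  have [|q1 e1] := h_mod (i + j)%N; first lia.
  have [|q2 e2] := h_mod (i + j')%N; first lia.
  have ejj : j = j'.
    have [jj|jj] := leqP j j'.
      have dv : (L %| j' - j)%N.
        apply: (coprime_dvdZ (z := q1 - q2 - k%:Z - 1) coprime_Lm).
        by rewrite -subzn //; rewrite e1 e2 !PoszD in e *; lia.
      by have := dvdn_leq _ dv; lia.
    have dv : (L %| j - j')%N.
      apply: (coprime_dvdZ (z := q2 - q1 + k%:Z + 1) coprime_Lm).
      by rewrite -subzn ?(ltnW jj) //; rewrite e1 e2 !PoszD in e *; lia.
    by have := dvdn_leq _ dv; lia.
  by rewrite ejj in e; have := mulr_ge0 (le0z_nat L) (le0z_nat k); lia.
have nDh j : (j <= L)%N -> ~ D (h (i + j)%N - L%:Z).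
  move=> jL; have [->|nj] := eqVneq j L; last by apply: nDh'; lia.
  by rewrite h_loop -[i in h i]addn0; apply: nDh'.
have DL x (k : nat) : D x -> D (x + L%:Z * k%:Z).
  move=> [j [k' [jL ->]]]; exists j, (k' + k)%N; split=> //.
  by rewrite (PoszD k' k) mulrDr addrA.
have hD : semimodule D.
  split.
  - move=> _ [j [k [jL ->]]]; rewrite -addrA (addrC _ n%:Z) addrA; apply: (DL _ _).
    (* Adding n goes one step back along the closed loop. *)
    have [j' [j'L e]] : exists j', (j' < L)%N /\ h (i + j').+1 = h (i + j)%N.
      case: j jL => [|j] jL; last by exists j; rewrite addnS; split=> //; lia.
      by exists L.-1; rewrite -addnS prednK // addn0 h_loop; split=> //; lia.
    have e3 : h (i + j').+1 = _ := heightS b (_ : (i + j' < size p)%N).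
    rewrite -e e3; last lia.
    rewrite /stride; case: eqP => _; last by rewrite addrNK; apply/Dh/ltnW.
    have -> : height b p (i + j') + m%:Z + n%:Z = h (i + j')%N + L%:Z * 1%:Z.
      by rewrite /h PoszD; lia.
    by apply/DL/Dh/ltnW.
  - move=> _ [j [k [jL ->]]]; rewrite -addrA (addrC _ m%:Z) addrA; apply: (DL _ _).
    have e3 : h (i + j).+1 = _ := heightS b (_ : (i + j < size p)%N).
    have := Dh _ jL; rewrite addnS e3; last lia.
    rewrite /stride; case: eqP => _ //.
    have -> : h (i + j)%N + m%:Z = h (i + j)%N - n%:Z + L%:Z * 1%:Z by lia.
    exact: DL.
  - by exists (h (i + 0)%N); apply: Dh.
  - exists b => _ [j [k [jL ->]]].
    by have := h_b (i + j)%N; have := mulr_ge0 (le0z_nat L) (le0z_nat k); lia.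
(* Each step of p leads to an Apéry element, as does the step of the rim; two
   different steps would lead to Apéry elements that differ by L. *)
have rimE k j : (j + k <= L)%N -> take k (drop (i + j) p) = rim D (h (i + j)%N) k.
  elim: k j => [|k IH] j jk; first by rewrite take0.
  have ijp : (i + j < size p)%N by lia.
  rewrite (drop_nth east) //=; rewrite -addnS IH; last lia.
  have e3 : h (i + j).+1 = _ := heightS b ijp.
  have jL : (j.+1 <= L)%N by lia.
  have := Dh _ jL; have := nDh _ jL; rewrite addnS e3 /stride -/(h (i + j)%N).
  case: asboolP => [Dn|nDn]; case: nth => //=.
  + by have -> : h (i + j)%N + m%:Z - L%:Z = h (i + j)%N - n%:Z by lia.
exists D, i; split=> //.
- by rewrite -/(h i) -[i in h i]addn0; split; [apply: Dh | apply: nDh].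
- by rewrite -/(h i) -{1 2}[i]addn0; apply: rimE.
- move=> j ij jp; have := i_last j; rewrite -/(h j) -/(h (j + L)%N).
  by case: lerP => // _ /(_ _); case; [lia|].
Qed.

(** The heights behind the loop are too low to be in D, and a tail loop of the
shorter path starts at i or before.  So by tail_loop_notin the Apéry element of
C in the class of the height at i is not below this height, which is in D. *)
Lemma tail_loop_cut b p D i : excursion p -> tail_loop b p D i ->
  let p' := cut_at i p in
  [/\ excursion p', last_visit b p' D i,
      insert_at i (rim D (height b p' i) L) p' = p
    & forall C k, tail_loop b p' C k -> meets C D].
Proof.
move=> hp tD; have [hD iLp aD e dec] := tD; set p' := cut_at i p => /=.
have sp : size p = (size p' + L)%N.
  by rewrite size_cat size_takel ?size_drop; lia.
have ip' : (i <= size p')%N by lia.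
have hi : height b p' i = height b p i.
  by rewrite /height takel_cat ?take_takel // size_takel //; lia.
have pE : insert_at i (rim D (height b p' i) L) p' = p.
  by rewrite hi -e insert_cut.
have w0 : rise (rim D (height b p' i) L) = 0 by rewrite hi rise_rim.
have h_after b' j : (i <= j)%N -> height b' p (j + L) = height b' p' j.
  move=> ij; rewrite -[in LHS]pE -[in (j + L)%N](size_rim D (height b p' i) L).
  by rewrite height_insert_after // -hi.
have h_before b' j : (j <= i)%N -> height b' p j = height b' p' j.
  by move=> ji; rewrite -[in LHS]pE height_insert_before.
split=> //.
- split; last first.
    have := hp.2; rewrite -pE /insert_at rise_cat rise_cat w0 add0r.
    by rewrite -rise_cat cat_take_drop.
  move=> j; suff : 0 <= height 0 p' j by rewrite /height add0r.
  have [ij|ji] := leqP i j; [rewrite -h_after // | rewrite -h_before ?(ltnW ji) //];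
    exact: excursion_height.
- split=> //; first by rewrite hi; case: aD.
  move=> j /andP[ij jp] Dj; have ijw := ltnW ij; rewrite -h_after // in Dj.
  apply: (tail_loop_notin (j := j) tD); first lia.
  have lt_h := dec j ij; have {}lt_h := lt_h (_ : (j + L <= size p)%N).
  have [|q e1] := @height_mod b p j; first lia.
  have [|q' e2] := @height_mod b p (j + L); first lia.
  have e3 : height b p j - L%:Z = height b p (j + L) + L%:Z * (q - q' - m%:Z - 1).
    by rewrite e1 e2 (PoszD j); ring.
  have le3 : height b p (j + L) <= height b p j - L%:Z.
    have [q0|q0] := lerP 0 (q - q' - m%:Z - 1).
      by rewrite e3 lerDl mulr_ge0.
    have : 0 <= L%:Z * - (q - q' - m%:Z) by apply: mulr_ge0; lia.
    by move: lt_h e3; rewrite mulrN mulrBr mulr1 => lt_h; have := lt_h _; lia.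
  exact: semimodule_le Dj le3 e3.
move=> C k tC; have [hC kLp aC eC decC] := tC.
have ki : (k <= i)%N.
  rewrite leqNgt; apply/negP => ik.
  have := dec (k + L)%N; rewrite h_after; last lia.
  rewrite h_after; last lia.
  have -> : height b p' (k + L) = height b p' k.
    by rewrite (height_loop hC aC) // rise_rim // addr0.
  by rewrite ltxx => H; suff : false by []; apply: H; lia.
have nC := tail_loop_notin tC (_ : (k <= i <= size p')%N).
have [a aA [q xE]] := apery_exists (height b p' i) hC.
exists a => //; have Di : D (height b p' i) by rewrite hi; case: aD.
have aE : a = height b p' i + L%:Z * - q by rewrite xE; ring.
have [q0|q0] := lerP 0 (- q).
  by apply: (semimodule_le hD Di _ aE); rewrite aE lerDl mulr_ge0.
case: nC; first lia.
apply: (semimodule_le (q := q - 1) hC aA.1); last by rewrite xE; ring.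
have : 0 <= L%:Z * (q - 1) by apply: mulr_ge0; lia.
by rewrite xE; lia.
Qed.

Lemma tail_loop_rim b D : semimodule D -> D b -> (forall y, D y -> b <= y) ->
  excursion (rim D b L) /\ tail_loop b (rim D b L) D 0.
Proof.
move=> hD Db Dmin; have aA : apery D b by split=> // /Dmin; lia.
have h0 p : height b p 0 = b by rewrite /height take0 rise_nil addr0.
have w0 : rise (rim D b L) = 0 by rewrite rise_rim.
split.
  split=> // i; have [iL|Li] := leqP i L.
    rewrite take_rim //; suff : b <= b + rise (rim D b i) by lia.
    by apply: Dmin; case: (apery_rim i hD aA).
  by rewrite take_oversize ?w0 // size_rim ltnW.
split=> //; rewrite ?h0 ?size_rim //.
- by rewrite drop0 take_rim.
- by move=> j; lia.
Qed.

(** * Chains of semimodules correspond to stacks of excursions *)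

Hypothesis d_gt0 : (0 < d)%N.

(** The latest semimodule comes first: an entry with k entries behind it consists
of the x with d x + s k in a set Delta of natural numbers. *)
Fixpoint module_chain (c : seq (set int)) : Prop :=
  if c is D :: c' then
    [/\ semimodule D, forall y, D y -> 0 <= d%:Z * y + s%:Z * (size c')%:Z,
        if c' is C :: _ then meets C D else D 0 & module_chain c']
  else True.

(** The encoding of chains by stacks, as a relation because it is used in both
directions.  A semimodule with a new record minimum -x opens a run in column x;
any other one prolongs the current run, and its rim is inserted. *)
Inductive cabling : seq (set int) -> seq (nat * seq step) -> Prop :=
| CablingNil : cabling [::] [::]
| CablingNew D c x st of cabling c st & semimodule D & D (- x%:Z) &
    (forall y, D y -> - x%:Z <= y) & opens st x & (d * x <= s * size c)%N :
    cabling (D :: c) ((x, rim D (- x%:Z) L) :: st)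
| CablingInsert D C c x p st i of cabling (C :: c) ((x, p) :: st) &
    semimodule D & (forall y, D y -> - x%:Z <= y) & meets C D &
    last_visit (- x%:Z) p D i :
    cabling (D :: C :: c)
      ((x, insert_at i (rim D (height (- x%:Z) p i) L) p) :: st).

(** A semimodule D with a new record minimum -x meets its predecessor C
automatically: all elements of C are larger than -x, so the Apéry element of C
in the class of -x is in D. *)
Lemma cabling_valid c st : cabling c st ->
  [/\ module_chain c, path_stack st, loops st = size c &
    match c, st with
    | [::], [::] => True
    | D :: _, (x, p) :: _ => (forall y, D y -> - x%:Z <= y) /\
        exists i, tail_loop (- x%:Z) p D i
    | _, _ => False
    end].
Proof.
have L_gt0 : (0 < L)%N by lia.
elim=> {c st} [|D c x st R [vc vs lc hd] hD Dx Dmin op bx|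
                D C c x p st i R [vc vs lc [Cmin [k tC]]] hD Dmin meet lv].
- by [].
- have [hp tD] := tail_loop_rim hD Dx Dmin.
  have size1 : size (rim D (- x%:Z) L) = L by rewrite size_rim.
  split=> //; last by split=> //; exists 0%N.
  + split=> //.
      by move=> y /Dmin y_ge; have := ler_wpM2l (le0z_nat d) y_ge; lia.
    case: c st R vc vs lc hd op bx => [|C c] [|[y q] st] R vc vs lc hd op bx //.
      by move: Dx; have -> : x = 0%N by move: bx; rewrite muln0; lia.
    case: hd vc => Cmin _ [hC _ _ _].
    have [a aC [z e]] := apery_exists (- x%:Z) hC; exists a => //.
    apply: (semimodule_le (q := - z) hD Dx); last by rewrite e; ring.
    by have := Cmin _ aC.1; move: op; rewrite /=; lia.
  + split=> //; last by rewrite lc.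
    by split=> //; exists 0%N; rewrite mul1n.
  + by rewrite /loops /= size1 divnn L_gt0 -/(loops st) lc.
- have [hp [v sp]] : excursion p /\ exists v, size p = (v.+1 * L)%N by case: vs.
  have [hp' tD] := tail_loop_insert hp tC hD Dmin meet lv.
  have sp' : size (insert_at i (rim D (height (- x%:Z) p i) L) p) = (v.+2 * L)%N.
    by rewrite size_insert_at size_rim sp -mulSnr.
  case: vs => _ op bx vs.
  have lst : loops st = (size c - v)%N /\ (v <= size c)%N.
    by move: lc; rewrite /loops /= sp mulnK //; lia.
  split=> //; last by split=> //; exists i.
  + split=> // y /Dmin y_ge; have := ler_wpM2l (le0z_nat d) y_ge.
    have : (s * loops st <= s * (size c).+1)%N by rewrite leq_mul2l; lia.
    by rewrite /=; lia.
  + by split=> //; split=> //; exists v.+1.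
  + by rewrite /loops /= sp' mulnK //= -/(loops st); lia.
Qed.

Lemma cabling_insert_tail D C c x p st i : cabling (C :: c) ((x, p) :: st) ->
    semimodule D -> (forall y, D y -> - x%:Z <= y) -> meets C D ->
    last_visit (- x%:Z) p D i ->
  tail_loop (- x%:Z) (insert_at i (rim D (height (- x%:Z) p i) L) p) D i.
Proof.
move=> /cabling_valid[_ [[hp _] _ _ _] _ [_ [k tC]]] hD Dmin meet lv.
by have [] := tail_loop_insert hp tC hD Dmin meet lv.
Qed.

Lemma cabling_size c x p st : cabling c ((x, p) :: st) -> (L <= size p)%N.
Proof.
by move=> /cabling_valid[_ [[_ [v ->]] _ _ _] _ _]; rewrite leq_pmull.
Qed.

Lemma cabling_exists c : module_chain c -> exists st, cabling c st.
Proof.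
elim: c => [|D c IH]; first by exists [::]; constructor.
case=> hD Dle meet /IH[st R]; have [_ vs lc hd] := cabling_valid R.
have [z Dz Dmin] := semimodule_min hD.
have new (x : nat) : z = - x%:Z -> opens st x -> exists st', cabling (D :: c) st'.
  move=> e op; exists ((x, rim D (- x%:Z) L) :: st); constructor=> //.
  - by rewrite -e.
  - by rewrite -e.
  - by have := Dle _ Dz; rewrite e; lia.
case: c st {IH} R vs lc hd meet Dle new => [|C c] [|[x p] st] R vs lc hd meet Dle new //.
  apply: (new 0%N) => //; have := Dmin _ meet; have := Dle _ Dz.
  by rewrite mulr0 addr0 oppr0 pmulr_rge0; lia.
have [xz|zx] := lerP (- x%:Z) z; last by apply: (new `|z|%N); rewrite /=; lia.
have Dx y : D y -> - x%:Z <= y by move=> /Dmin; apply: le_trans.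
(* D contains an Apéry element of C, and this is a height of the tail loop. *)
case: hd => _ [k tC]; have [hC kLp aC e _] := tC; case: (meet) => a aA Da.
have [j jL aj] := rim_apery hC aC aA.
have [||i [/andP[_ ip] Di last_i]] := @exists_last
    (fun i => D (height (- x%:Z) p i)) (k + j) (size p); first lia.
  by rewrite (height_loop hC aC) ?(ltnW jL) // -aj.
exists ((x, insert_at i (rim D (height (- x%:Z) p i) L) p) :: st).
exact: CablingInsert R hD Dx meet _.
Qed.

(** By induction on the number of loops: the tail loop of the latest path gives the
latest semimodule, and cutting it out leaves a smaller stack. *)
Lemma cabling_onto st : path_stack st -> exists c, cabling c st.
Proof.
have L_gt0 : (0 < L)%N by lia.
have [k] := ubnP (loops st); elim: k st => // k IH [|[x p] st] lt_k.
  by exists [::]; constructor.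
case=> [[hp [v sp]] op bx vs].
have lp : loops ((x, p) :: st) = (v.+1 + loops st)%N.
  by rewrite /loops /= sp mulnK.
have [|D [i tD]] := @tail_loop_exists (- x%:Z) p hp; first by rewrite sp leq_pmull.
have Dmin := tail_loop_bound hp tD.
have [hD iLp aD e _] := tD.
have [hp' lv pE meet] := tail_loop_cut hp tD.
case: v sp lp => [|v] sp lp.
  have i0 : i = 0%N by rewrite sp mul1n in iLp; lia.
  have h0 : height (- x%:Z) p i = - x%:Z.
    by rewrite i0 /height take0 rise_nil addr0.
  have [|c R] := IH st _ vs; first lia.
  exists (D :: c).
  have -> : p = rim D (- x%:Z) L.
    by rewrite -h0 -e i0 drop0 take_oversize // sp mul1n.
  have [_ _ lc _] := cabling_valid R.
  by constructor=> //; [rewrite -h0; case: aD | rewrite -lc].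
have sp' : size (cut_at i p) = (v.+1 * L)%N.
  by have := size_insert_at i (take L (drop i p)) (cut_at i p);
    rewrite insert_cut e size_rim sp; lia.
have [| |[|C c] R] := IH ((x, cut_at i p) :: st).
- by rewrite /loops /= sp' mulnK // -/(loops st); lia.
- by split=> //; split=> //; exists v.
- by have [] := cabling_valid R.
have [_ _ _ [_ [l tC]]] := cabling_valid R.
exists (D :: C :: c); rewrite -pE; apply: CablingInsert => //.
exact: meet tC.
Qed.

Lemma cabling_functional c st st' : cabling c st -> cabling c st' -> st = st'.
Proof.
move=> R; elim: R st' => {c st} [|D c x st R IH hD Dx Dmin op bx|
                D C c x p st i R IH hD Dmin meet lv] st' R'.
- by inversion R'.
- inversion R' as [|D1 c1 x1 st1 R1 hD1 Dx1 Dmin1 op1 bx1 eD est|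
      D1 C1 c1 x1 p1 st1 i1 R1 hD1 Dmin1 meet1 lv1 eD est]; subst.
    rewrite -(IH _ R1); have -> // : x = x1.
    by have := Dmin _ Dx1; have := Dmin1 _ Dx; lia.
  move: op; rewrite (IH _ R1) /=; have := Dmin1 _ Dx; lia.
- inversion R' as [|D1 c1 x1 st1 R1 hD1 Dx1 Dmin1 op1 bx1 eD est|
      D1 C1 c1 x1 p1 st1 i1 R1 hD1 Dmin1 meet1 lv1 eD est]; subst.
    by move: op1; rewrite -(IH _ R1) /=; have := Dmin _ Dx1; lia.
  have [<- <- <-] := IH _ R1.
  have [ex ep _] := IH _ R1; subst x1 p1.
  have -> // : i = i1.
  case: lv => ip Di last_i; case: lv1 => ip1 Di1 last_i1.
  have [lt|gt|//] := ltngtP i i1.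
  + by case: (last_i i1); rewrite ?lt.
  + by case: (last_i1 i); rewrite ?gt.
Qed.

Lemma cabling_injective c c' st : cabling c st -> cabling c' st -> c = c'.
Proof.
move=> R; elim: R c' => {c st} [|D c x st R IH hD Dx Dmin op bx|
                D C c x p st i R IH hD Dmin meet lv] c' R'.
- by inversion R'.
- inversion R' as [|D1 c1 x1 st1 R1 hD1 Dx1 Dmin1 op1 bx1 eD [ex ep est]|
      D1 C1 c1 x1 p1 st1 i1 R1 hD1 Dmin1 meet1 lv1 eD [ex ep est]]; subst.
    rewrite (IH _ R1); congr (_ :: _); apply: (rim_inj hD hD1) (esym ep).
    + by split=> // /Dmin; lia.
    + by split=> // /Dmin1; lia.
  have := congr1 size ep; rewrite size_insert_at !size_rim.
  by have := cabling_size R1; lia.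
- inversion R' as [|D1 c1 x1 st1 R1 hD1 Dx1 Dmin1 op1 bx1 eD [ex ep est]|
      D1 C1 c1 x1 p1 st1 i1 R1 hD1 Dmin1 meet1 lv1 eD [ex ep est]]; subst.
    have := congr1 size ep; rewrite size_insert_at !size_rim.
    by have := cabling_size R; lia.
  have t := cabling_insert_tail R hD Dmin meet lv.
  have t1 := cabling_insert_tail R1 hD1 Dmin1 meet1 lv1.
  have [ip _ _] := lv; have [ip1 _ _] := lv1.
  have ei : i1 = i by rewrite ep in t1; have [] := tail_loop_uniq t1 t.
  have eD : D1 = D by rewrite ep in t1; have [] := tail_loop_uniq t1 t.
  subst i1 D1; congr (_ :: _).
  have pp : p1 = p.
    by have := congr1 (cut_at i) ep; rewrite !cut_insert ?size_rim.
  by apply: IH; rewrite -pp.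
Qed.

End Cabling.

(** * Splitting a set of natural numbers into semimodules *)

Section Components.
Local Open Scope ring_scope.
Variables d s : nat.
Hypothesis d_gt0 : (0 < d)%N.
Hypothesis coprime_ds : coprime d s.

(** Numbering the classes by s k rather than k makes the shift by s in the
admissibility condition lead from each component to the next; component d is
component 0 shifted by -s. *)
Definition component (Delta : set nat) (k : nat) : set int :=
  fun x => exists2 y : nat, Delta y & y%:Z = d%:Z * x + s%:Z * k%:Z.

Fixpoint component_chain (Delta : set nat) (k : nat) : seq (set int) :=
  if k is k'.+1 then component Delta k' :: component_chain Delta k' else [::].

Lemma component_mem Delta k x (y : nat) : y%:Z = d%:Z * x + s%:Z * k%:Z ->
  component Delta k x <-> Delta y.
Proof.
move=> e; split=> [[y' Dy' e']|Dy]; last by exists y.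
by have -> : y = y' by lia.
Qed.

Lemma component_ge0 Delta k x : component Delta k x ->
  0 <= d%:Z * x + s%:Z * k%:Z.
Proof. by case=> y _ <-. Qed.

Lemma residue_split (y : int) :
  exists2 k, (k < d)%N & exists x : int, y = d%:Z * x + s%:Z * k%:Z.
Proof.
have [k kd [x e]] := coprime_combination y d_gt0 coprime_ds.
by exists k => //; exists x; rewrite e addrC.
Qed.

Lemma residue_uniq k k' (x x' : int) : (k < d)%N -> (k' < d)%N ->
  d%:Z * x + s%:Z * k%:Z = d%:Z * x' + s%:Z * k'%:Z -> k = k' /\ x = x'.
Proof.
move=> kd k'd e.
have le l l' (z z' : int) : (l < d)%N -> (l <= l')%N -> (l' < d)%N ->
    d%:Z * z + s%:Z * l%:Z = d%:Z * z' + s%:Z * l'%:Z -> l = l'.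
  move=> ld ll l'd eq; have dv : (d %| l' - l)%N.
    apply: (coprime_dvdZ (z := z - z') coprime_ds).
    by rewrite -subzn // mulrBl mulrBr [_ * s%:Z]mulrC [l%:Z * _]mulrC; lia.
  by have [|] := posnP (l' - l)%N; [lia|move=> /dvdn_leq/(_ dv); lia].
have kk : k = k'.
  have [kk|kk] := leqP k k'; first exact: le e.
  by apply/esym; apply: (le _ _ x' x _ (ltnW kk)).
split=> //; subst k'; have d0 : d%:Z != 0 :> int by lia.
by apply: (mulfI d0); lia.
Qed.

Lemma size_component_chain Delta k : size (component_chain Delta k) = k.
Proof. by elim: k => //= k ->. Qed.

Lemma nth_component_chain Delta k K : (k < K)%N ->
  nth set0 (component_chain Delta K) (K - k.+1) = component Delta k.
Proof.
elim: K => // K IH kK; have [->|nk] := eqVneq k K; first by rewrite subnn.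
by rewrite subSn /= ?IH //; lia.
Qed.

Lemma component_chain_inj Delta Delta' :
  component_chain Delta d = component_chain Delta' d -> Delta = Delta'.
Proof.
move=> e; apply/funext => y; apply/propext.
have [k kd [x ye]] := residue_split y%:Z.
rewrite -(component_mem Delta ye) -(component_mem Delta' ye).
by rewrite -!(nth_component_chain _ kd) e.
Qed.

End Components.

Section Admissible.
Import Order.TTheory Num.Theory.
Local Open Scope ring_scope.
Variables n m d s : nat.
Hypothesis n_gt0 : (0 < n)%N.
Hypothesis m_gt0 : (0 < m)%N.
Hypothesis coprime_nm : coprime n m.
Hypothesis d_gt0 : (0 < d)%N.
Hypothesis coprime_ds : coprime d s.
Local Notation semimodule := (semimodule n m).
Local Notation meets := (meets n m).
Local Notation module_chain := (module_chain n m d s).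
Local Notation component := (component d s).
Local Notation component_chain := (component_chain d s).

Lemma cofinite_bound Delta : cofinite Delta ->
  exists B : nat, forall y, (B <= y)%N -> Delta y.
Proof.
move=> /finite_seqP[l lE]; exists (\max_(x <- l) x).+1 => y By.
have [//|nDy] := pselect (Delta y).
have : (~` Delta)%classic y by [].
by rewrite lE /= => yl; have := @leq_bigmax_seq _ l xpredT id y yl isT; lia.
Qed.

Lemma component_semimodule Delta k : cofinite Delta ->
  Defs.invariant (n * d) (m * d) Delta -> semimodule (component Delta k).
Proof.
move=> /cofinite_bound[B DB] [Dn Dm]; split.
- move=> x [y Dy e]; exists (y + n * d)%N; first exact: Dn.
  by rewrite PoszD PoszM e; ring.
- move=> x [y Dy e]; exists (y + m * d)%N; first exact: Dm.
  by rewrite PoszD PoszM e; ring.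
- exists B%:Z; exists (d * B + s * k)%N; first by apply: DB; nia.
  by rewrite PoszD !PoszM.
- exists (- (s%:Z * k%:Z)) => x /component_ge0 h.
  have [x0|x0] := lerP 0 x; first by have := mulr_ge0 (le0z_nat s) (le0z_nat k); lia.
  (* For x < 0, d x <= x because d >= 1. *)
  have : 0 <= (d%:Z - 1) * (- x) by apply: mulr_ge0; lia.
  by rewrite mulrBl mul1r mulrN; lia.
Qed.

(** The generators congruent to s k modulo d are the d x + s k with x an
n-generator of component k, and adding m d + s to such a number leads to
d (x + m) + s (k + 1). *)
Lemma admissibleP Delta : cofinite Delta -> Defs.invariant (n * d) (m * d) Delta ->
  admissible n m d s Delta <->
  forall k, (k < d)%N -> meets (component Delta k) (component Delta k.+1).
Proof.
move=> cD iD; have hC k := component_semimodule k cD iD; split=> adm.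
- move=> k kd; apply/(meets_generatorP n_gt0 m_gt0 coprime_nm) => //.
  have [|a [[Da nDa] aj Das]] := adm ((s * k) %% d)%N; first by rewrite ltn_mod.
  rewrite modn_mod in aj.
  have [x e] : exists x : int, a%:Z = d%:Z * x + s%:Z * k%:Z.
    exists ((a %/ d)%N%:Z - ((s * k) %/ d)%N%:Z).
    have := divn_eq a d; have := divn_eq (s * k) d; rewrite aj; lia.
  exists x; split; first by exists a.
  + move=> [b Db eb]; apply: nDa; exists b => //.
    by move: e eb; rewrite mulrBr; lia.
  + by exists (a + m * d + s)%N; rewrite // -(addn1 k) !PoszD PoszM e; ring.
move=> j jd; have [k kd [q je]] := residue_split d_gt0 coprime_ds j%:Z.
have /(meets_generatorP n_gt0 m_gt0 coprime_nm (hC k) (hC k.+1))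
  [x [[a Da e] nDx [b Db eb]]] := adm k kd.
exists a; split.
- split=> // -[c Dc ec]; apply: nDx; exists c => //.
  by move: e; rewrite -ec PoszD PoszM mulrBr; lia.
- have eaj : a%:Z = j%:Z + d%:Z * (x - q) by rewrite je e; ring.
  have [xq|xq] := lerP q x.
    have -> : a = (`|x - q| * d + j)%N by nia.
    by rewrite modnMDl.
  have -> : j = (`|x - q| * d + a)%N by nia.
  by rewrite modnMDl.
- have -> : (a + m * d + s)%N = b by move: e eb; rewrite mulrDr; nia.
  exact: Db.
Qed.

Lemma component_chain_valid Delta : admissible_sets n m d s Delta ->
  module_chain (component_chain Delta d).
Proof.
move=> [cD D0 adm iD]; have hC k := component_semimodule k cD iD.
have {}adm := (admissibleP cD iD).1 adm.
suff H K : (K <= d)%N -> module_chain (component_chain Delta K) by apply: H.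
elim: K => //= k IH kd; split=> //.
- by move=> y; rewrite size_component_chain => /component_ge0.
- case: k kd {IH} => [|k] kd /=; last by apply: adm; lia.
  by exists 0%N => //; rewrite !mulr0.
- by apply: IH; lia.
Qed.

(** A chain controls the pairs of consecutive components with index below d.  The
remaining pair, made of component d - 1 and component 0 shifted by -s, meets
since all elements x of the former satisfy 0 <= d x + s (d - 1), so x > -s. *)
Lemma component_chain_onto c : module_chain c -> size c = d ->
  exists2 Delta, admissible_sets n m d s Delta & component_chain Delta d = c.
Proof.
move=> vc sc; pose C k := nth set0 c (d - k.+1).
pose Delta : set nat :=
  fun y => exists k x, [/\ (k < d)%N, C k x & y%:Z = d%:Z * x + s%:Z * k%:Z].
have valid_drop j : module_chain (drop j c).
  elim: c j vc {sc C Delta} => [|D c IH] [|j] //= [_ _ _ vc]; exact: IH.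
have valid k : (k < d)%N -> [/\ semimodule (C k),
    forall y, C k y -> 0 <= d%:Z * y + s%:Z * k%:Z &
    if k is k'.+1 then meets (C k') (C k) else C k 0].
  move=> kd; have := valid_drop (d - k.+1)%N.
  rewrite (drop_nth set0) /=; last by rewrite sc; lia.
  rewrite -/(C k) size_drop sc (_ : d - (d - k.+1).+1 = k)%N; last lia.
  case=> hC C_ge; case: k kd hC C_ge => [|k] kd hC C_ge.
    by rewrite drop_oversize //; rewrite sc; lia.
  rewrite (drop_nth set0); last by rewrite sc; lia.
  by rewrite (_ : (d - k.+2).+1 = d - k.+1)%N //; lia.
have componentE k : (k < d)%N -> component Delta k = C k.
  move=> kd; apply/funext => x; apply/propext; split.
    move=> [y [k' [x' [k'd Cx' ->]]] e].
    by have [<- <-] := residue_uniq d_gt0 coprime_ds k'd kd e.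
  move=> Cx; have [_ C_ge _] := valid k kd; have := C_ge _ Cx => y_ge.
  exists (absz (d%:Z * x + s%:Z * k%:Z)); last by lia.
  by exists k, x; split=> //; lia.
have cD : cofinite Delta.
  have [B CB] : exists B : nat, forall k x, (k < d)%N -> B%:Z <= x -> C k x.
    suff H K : (K <= d)%N -> exists B : nat, forall k x, (k < K)%N -> B%:Z <= x -> C k x.
      exact: H.
    elim: K => [|K IH] Kd; first by exists 0%N.
    have [|B CB] := IH _; first lia.
    have [hK _ _] := valid K Kd.
    have [B' CB'] := semimodule_large n_gt0 m_gt0 coprime_nm hK.
    exists (B + B')%N => k x; rewrite ltnS leq_eqVlt => /orP[/eqP->|kK] Bx.
      by apply: CB'; lia.
    by apply: CB => //; lia.
  apply: (@sub_finite_set _ _ `I_(d * B + s * d)) (finite_II _) => y /= nDy.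
  rewrite ltnNge; apply/negP => yB; apply: nDy.
  have [k kd [x e]] := residue_split d_gt0 coprime_ds y%:Z; exists k, x.
  split=> //; apply: CB => //.
  have [//|xB] := lerP B%:Z x.
  have : (s * k <= s * d)%N by rewrite leq_mul2l (ltnW kd) orbT.
  have : 0 <= d%:Z * (B%:Z - 1 - x) by apply: mulr_ge0; lia.
  by rewrite !mulrBr mulr1; lia.
have iD : Defs.invariant (n * d) (m * d) Delta.
  split=> y [k [x [kd Cx e]]]; have [[Cn Cm _ _] _ _] := valid k kd.
  - by exists k, (x + n%:Z); split; [|exact: Cn | rewrite PoszD PoszM e; ring].
  - by exists k, (x + m%:Z); split; [|exact: Cm | rewrite PoszD PoszM e; ring].
have hC k := component_semimodule k cD iD.
have D0 : Delta 0%N.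
  by have [_ _ C0] := valid 0%N d_gt0; exists 0%N, 0; rewrite !mulr0.
exists Delta.
  split=> //; apply/(admissibleP cD iD) => k kd.
  have [ekd|nkd] := eqVneq k.+1 d; last first.
    have k1d : (k.+1 < d)%N by lia.
    by rewrite !componentE //; have [_ _] := valid k.+1 k1d.
  have Ds : component Delta k.+1 (- s%:Z).
    by exists 0%N => //; rewrite ekd; lia.
  have [a aA [q e]] := apery_exists n_gt0 m_gt0 coprime_nm (- s%:Z) (hC k).
  exists a => //.
  apply: (semimodule_le (q := - q) (hC k.+1) Ds); last by rewrite e; ring.
  have := component_ge0 aA.1 => a_ge.
  have [//|a_lt] := lerP (- s%:Z) a.
  have : 0 <= d%:Z * (- s%:Z - a - 1) by apply: mulr_ge0; lia.
  have : (s * k <= s * d)%N by rewrite leq_mul2l (ltnW kd) orbT.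
  by rewrite !mulrBr mulr1 mulrN; lia.
have H K : (K <= d)%N -> component_chain Delta K = drop (d - K) c.
  elim: K => [|K IH] Kd; first by rewrite subn0 drop_oversize // sc.
  rewrite /= componentE // IH ?(ltnW Kd) // [RHS](drop_nth set0); last by rewrite sc; lia.
  by rewrite (_ : (d - K.+1).+1 = d - K)%N //; lia.
by rewrite H // subnn drop0.
Qed.

End Admissible.

(** * The bijection *)

Lemma set_bij_of_rel (T U : Type) (u0 : U) (A : set T) (B : set U)
    (R : T -> U -> Prop) :
    (forall a, A a -> exists2 b, B b & R a b) ->
    (forall b, B b -> exists2 a, A a & R a b) ->
    (forall a b b', R a b -> R a b' -> b = b') ->
    (forall a a' b, R a b -> R a' b -> a = a') ->
  exists f : T -> U, set_bij A B f.
Proof.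
move=> total onto functional injective.
have [a|f fP] := choice (P := fun a b => A a -> B b /\ R a b).
  have [/total[b Bb Rab]|nAa] := pselect (A a); first by exists b.
  by exists u0.
exists f; split.
- by move=> a /fP[].
- move=> a a' /set_mem/fP[_ Ra] /set_mem/fP[_ Ra'] e.
  by apply: (injective _ _ _ Ra); rewrite e.
- move=> b /onto[a Aa Rab]; exists a => //.
  by have [_ Ra] := fP a Aa; apply: (functional _ _ _ Ra Rab).
Qed.

Theorem theorem1p9 (m n d s : nat) (hm : 1 <= m) (hn : 1 <= n) (hd : 1 <= d)
  (hs : 1 <= s) (hmn : coprime m n) (hds : coprime d s) :
  exists f : set nat -> seq step * seq (seq step),
    set_bij (admissible_sets n m d s) (cabled_dyck_paths n m d s) f.
Proof.
have hnm : coprime n m by rewrite coprime_sym.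
apply: (@set_bij_of_rel _ _ ([::], [::]) _ _ (fun Delta PQ => exists2 st,
  cabling n m d s (component_chain d s Delta d) st & cabled_code n m s st = PQ)).
- move=> Delta /(component_chain_valid hn hm hnm hd hds) vc.
  have [st R] := cabling_exists hn hm hnm hd vc.
  have [_ vst ld _] := cabling_valid hn hm hnm hd R.
  exists (cabled_code n m s st); last by exists st.
  apply: cabled_code_in => //.
  by rewrite ld size_component_chain.
- move=> PQ /(cabled_code_onto hn hm hd)[st [vst ld <-]].
  have [c R] := cabling_onto hn hm hnm hd vst.
  have [vc _ lc _] := cabling_valid hn hm hnm hd R.
  have [|Delta AD cE] := component_chain_onto hn hm hnm hd hds vc.
    by rewrite -lc ld.
  by exists Delta => //; exists st; rewrite ?cE.
- move=> Delta PQ PQ' [st R <-] [st' R' <-].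
  by rewrite (cabling_functional hn hm hnm hd R R').
- move=> Delta Delta' PQ [st R <-] [st' R' e].
  have [_ vst _ _] := cabling_valid hn hm hnm hd R.
  have [_ vst' _ _] := cabling_valid hn hm hnm hd R'.
  have est : st' = st by apply: (cabled_code_inj hn hm hd vst' vst).
  rewrite est in R'; have e2 := cabling_injective hn hm hnm hd R R'.
  exact: (component_chain_inj hd hds e2).
Qed.
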